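(* Let $(X,T)$ be a transitive weak Banach mean equicontinuous topological dynamical system. Then $(X,T)$ is uniquely ergodic.
   Context: A topological dynamical system $(X,T)$ is a compact metric space $X$ with metric $d$ together with a continuous map $T:X\to X$. Transitive means topologically transitive in the usual sense: for all nonempty open $U,V\subset X$ there is $n\ge 0$ with $U\cap T^{-n}V\neq\emptyset$. For integers $0\le m<n$, $S_{n,m}$ is the group of permutations of $\{m,m+1,\dots,n-1\}$. For a real family $(a_{m,n})_{0\le m<n}$, $\limsup_{n-m\to+\infty}a_{m,n}=\lim_{N\to\infty}\sup\{a_{m,n}: n-m\ge N\}$. Define $$\overline{BF}(x,y)=\limsup_{n-m\to+\infty}\ \inf_{\sigma\in S_{n,m}}\frac1{n-m}\sum_{k=m}^{n-1}d(T^kx,T^{\sigma(k)}y).$$ $(X,T)$ is weak Banach mean equicontinuous (equivalently, $\overline{BF}$-continuous) if for every $x\in X$ and every $\varepsilon>0$ there is $\delta>0$ such that $d(x,y)<\delta$ implies $\overline{BF}(x,y)<\varepsilon$. $(X,T)$ is uniquely ergodic if it has exactly one ergodic $T$-invariant Borel probability measure (equivalently, exactly one $T$-invariant Borel probability measure). *)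

(* Defs.v *)
From HB Require Import structures.
From mathcomp Require Import all_boot all_order all_algebra all_fingroup.
From mathcomp Require Import all_classical all_reals all_analysis.

Set Implicit Arguments.
Unset Strict Implicit.
Unset Printing Implicit Defensive.

Import Order.TTheory GRing.Theory Num.Theory.

Local Open Scope classical_set_scope.
Local Open Scope ring_scope.

(* Nonempty metric spaces; the library generates sigma-algebras on pointed
   types only. *)
#[short(type="pointedMetricType")]
HB.structure Definition PointedMetric (K : numDomainType) :=
  {M of Metric K M & isPointed M}.

Notation borel X := (g_sigma_algebraType (@open X)).

Definition topologically_transitive (X : topologicalType) (T : X -> X) : Prop :=
  forall U V : set X, open U -> open V -> U !=set0 -> V !=set0 ->
    exists n : nat, U `&` iter n T @^-1` V !=set0.

Section weak_banach_mean_equicontinuity.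
Context {R : realType} {X : metricType R} (T : X -> X).

(* The permutations of {m, ..., n-1} are encoded as the permutations of 'I_n
   supported in it. *)
Definition perm_average (x y : X) (m n : nat) (s : {perm 'I_n}) : R :=
  (n - m)%:R^-1 *
  \sum_(k < n | (m <= k)%N) mdist (iter k T x) (iter (s k) T y).

Definition inf_perm_average (x y : X) (m n : nat) : R :=
  inf [set perm_average x y m s | s in [set s | s \in Sym [set k : 'I_n | (m <= k)%N]]].

(* The limit superior is taken in \bar R, where the suprema and the limit of the
   nonincreasing sequence they form always exist. *)
Definition BF (x y : X) : \bar R :=
  limn (fun N : nat => ereal_sup
    [set (inf_perm_average x y p.1 p.2)%:E
       | p in [set p : nat * nat | (p.1 < p.2)%N /\ (N <= p.2 - p.1)%N]]).

Definition weak_Banach_mean_equicontinuous : Prop :=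
  forall (x : X) (e : R), 0 < e ->
    exists2 delta : R, 0 < delta &
      forall y : X, mdist x y < delta -> (BF x y < e%:E)%E.

End weak_banach_mean_equicontinuity.

Section unique_ergodicity.
Context {R : realType} {X : pointedMetricType R} (T : X -> X).

Definition invariant_measure (mu : probability (borel X) R) : Prop :=
  forall A : set (borel X), measurable A -> mu (T @^-1` A) = mu A.

Definition ergodic_measure (mu : probability (borel X) R) : Prop :=
  invariant_measure mu /\
  forall A : set (borel X), measurable A -> T @^-1` A = A ->
    mu A = 0%E \/ mu A = 1%E.

(* Measures are total on set X, with irrelevant values off the Borel sets. *)
Definition uniquely_ergodic : Prop :=
  exists2 mu : probability (borel X) R, ergodic_measure mu &
    forall nu : probability (borel X) R, ergodic_measure nu ->
      forall A : set (borel X), measurable A -> nu A = mu A.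

End unique_ergodicity.

(* Main.v *)
(** For continuous [f] write [A_n f x] for the average of [f] over the first [n]
points of the orbit of [x]. A permutation of the orbit segments does not change
these averages, so if [BF T x y] is small then [A_n f x - A_n f y] is eventually
small. Given [x] and [y], transitivity yields a point near [x] with an iterate
near [y], and averages along an orbit do not see a shift; hence
[A_n f x - A_n f y] tends to [0] for all [x] and [y].

A limit of [A_n f] at a fixed point along an ultrafilter is an invariant
positive normalized functional [c], from which a Daniell-type outer measure produces an
invariant probability [mu]. Integrating [A_n f x - A_n f y] in [y] over an
invariant set [D] for any invariant probability [nu] gives, by dominated
convergence, that the integral of [f] over [D] is [c f * nu D]. Comparing with
the outer measure, [nu (A `&` D) <= mu A * nu D]. The case [D = setT] is
uniqueness, and the case [nu = mu], [A = D] is ergodicity. *)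
From HB Require Import structures.
Require Import Defs.
From mathcomp Require Import all_boot all_order all_algebra all_fingroup.
From mathcomp Require Import all_classical all_reals all_analysis.
From mathcomp Require Import measurable_realfun ring lra.

Set Implicit Arguments.
Unset Strict Implicit.
Unset Printing Implicit Defensive.

Import Order.TTheory GRing.Theory Num.Theory.
Import numFieldNormedType.Exports.

Local Open Scope classical_set_scope.
Local Open Scope ring_scope.

(** * Continuous real functions on a compact metric space *)

Section continuous_functions.
Context {R : realType} {X : metricType R}.
Hypothesis X_compact : compact [set: X].
Implicit Type f : X -> R.

Lemma continuous_bounded f : continuous f ->
  exists2 B, 0 < B & forall x, `|f x| <= B.
Proof.
move=> cf.
have : compact (f @` setT) by apply: continuous_compact => //;
  exact: continuous_subspaceT.
move=> /compact_bounded/ex_strict_bound_gt0[k k0 /= Hk].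
by exists k => // x; apply/ltW/Hk; exists x.
Qed.

(** Uniform continuity in affine form, so that it can be summed over orbit segments: nearby points
    cost at most [e], and for distant ones the term [C * mdist u v] exceeds twice the bound of
    [f]. *)
Lemma continuous_modulus f (e : R) : continuous f -> 0 < e ->
  exists2 C, 0 <= C & forall u v, `|f u - f v| <= e + C * mdist u v.
Proof.
move=> cf e0; have [B B0 HB] := continuous_bounded cf.
suff [C [C_ge0 C0]] : exists C, 0 <= C /\ forall u, [set: X] u ->
    forall v, `|f u - f v| <= e + C * mdist u v by exists C => // u v;
      exact: C0.
apply: (@filter_ex _ (pinfty_nbhs R)).
apply: filterI; first exact: nbhs_pinfty_ge.
have cov := (compact_near_coveringP _).1 X_compact.
apply: (cov R (pinfty_nbhs R)
  (fun C u => forall v, `|f u - f v| <= e + C * mdist u v)) => x _.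
have /cvgrPdist_lt/(_ _ (divr_gt0 e0 (ltr0n _ 2))) := cf x.
move=> /metricType_numDomainType.nbhs_mdistP[d /= d0 Hd].
(* Halving [d] keeps every [v] within [d / 2] of [u] inside the ball of radius [d] around [x]; for
   the remaining [v] the lower bound on [C] gives [2 * B <= C * mdist u v]. *)
exists (ball x (d / 2), [set C | 2 * B / (d / 2) <= C]) => /=.
  split; first by apply: nbhsx_ballx; rewrite divr_gt0.
  by apply: nbhs_pinfty_ge; exact: num_real.
move=> [u C] /= [xu BC] v.
have C0 : 0 <= C by apply: le_trans BC; rewrite divr_ge0 ?mulr_ge0 ?ltW.
rewrite ballEmdist /= in xu.
have [uv|uv] := ltP (mdist u v) (d / 2).
  have h1 : `|f x - f u| < e / 2 by apply: Hd => /=; lra.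
  have h2 : `|f x - f v| < e / 2.
    by apply: Hd => /=; have := metric_triangle x u v; lra.
  rewrite (le_trans _ (_ : e <= _)) ?lerDl ?mulr_ge0 ?mdist_ge0//.
  by rewrite (le_trans (ler_distD (f x) _ _))// distrC; lra.
rewrite (le_trans (ler_normB _ _))//.
have : 2 * B <= C * mdist u v.
  apply: (@le_trans _ _ (C * (d / 2))); last by rewrite ler_wpM2l.
  by rewrite -ler_pdivrMr// divr_gt0.
by have := HB u; have := HB v; lra.
Qed.
End continuous_functions.

(** * Orbit averages and their independence of the starting point *)

Definition avg {R : realType} {X : Type} (T : X -> X)
    (f : X -> R) (x : X) (n : nat) : R :=
  n%:R^-1 * \sum_(k < n) f (iter k T x).

Section averages.
Context {R : realType} {X : metricType R} (T : X -> X).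
Hypothesis X_compact : compact [set: X].
Implicit Type f : X -> R.

(** The suprema defining [BF] decrease in [N], so their limit is an infimum and one of them is
    already below [eta]. Only the windows starting at [m = 0] are extracted, since [avg] uses
    initial orbit segments. *)
Lemma BF_lt x y (eta : R) : (BF T x y < eta%:E)%E ->
  exists N : nat, forall n, (N < n)%N -> exists s : {perm 'I_n},
    n%:R^-1 * \sum_(k < n) mdist (iter k T x) (iter (s k) T y) < eta.
Proof.
rewrite /BF; set u := (fun N : nat => _).
have nu : nonincreasing_seq u.
  move=> m n mn; apply: ereal_sup_le => _ [p [p1 p2] <-]; exists p => //;
    split => //.
  exact: leq_trans p2.
rewrite (cvg_lim _ (ereal_nonincreasing_cvgn nu))// =>
  /ereal_inf_lt[_ [N _ <-]] uN.
exists N => n Nn.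
have : inf_perm_average T x y 0 n < eta.
  rewrite -lte_fin; apply: le_lt_trans uN; apply: ereal_sup_ubound.
  exists (0%N, n) => //=; rewrite subn0; split;
    [exact: leq_ltn_trans Nn|exact: ltnW].
(* The first goal is nonemptiness of the set of averages, witnessed by the identity permutation. *)
move=> /inf_lt [|_ [s _ <-] h].
  exists (perm_average T x y 0 (1%g : {perm 'I_n})), 1%g => //=; rewrite inE;
    exact: perm_on1.
by exists s; move: h; rewrite /perm_average subn0.
Qed.

Lemma BF_avg_near f (e : R) : continuous f -> 0 < e ->
  exists2 eta, 0 < eta & forall x y, (BF T x y < eta%:E)%E ->
    \forall n \near \oo, `|avg T f x n - avg T f y n| <= e.
Proof.
move=> cf e0.
have [C C0 fC] := continuous_modulus X_compact cf (divr_gt0 e0 (ltr0n _ 2)).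
have C1 : 0 < C + 1 by lra.
(* The average of [e / 2 + C * mdist] must stay below [e]; dividing by [C + 1] is safe even when [C]
   is zero. *)
exists (e / 2 / (C + 1)) => [|x y /BF_lt[N HN]]; first by rewrite !divr_gt0.
exists N.+1 => // n /= Nn; have [s sP] := HN _ Nn.
have n0 : 0 < n%:R :> R.
  by rewrite ltr0n (leq_ltn_trans _ Nn).
(* Reindexing the sum along the orbit of [y] by [s] leaves it unchanged and pairs its terms with
   those of the orbit of [x] as in the bound on distances. *)
rewrite /avg [X in _ - _ * X](reindex_inj (@perm_inj _ s))/= -mulrBr -sumrB.
rewrite normrM ger0_norm ?invr_ge0 ?ler0n// mulrC ler_pdivrMr//.
apply: (le_trans (ler_norm_sum _ _ _)).
apply: (@le_trans _ _ (\sum_(k < n) (e / 2 + C * mdist (iter k T x)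
  (iter (s k) T y)))).
  by apply: ler_sum => k _; exact: fC.
rewrite big_split/= sumr_const card_ord -mulr_natr -mulr_sumr.
set S := \sum_(k < n) _ in sP *.
have S0 : 0 <= S by apply: sumr_ge0 => k _; exact: mdist_ge0.
have {}sP : S * (C + 1) < e / 2 * n%:R by rewrite -ltr_pdivlMr// mulrAC
  -ltr_pdivrMr// mulrC.
by nra.
Qed.

Lemma avg_shift f z : continuous f ->
  (avg T f (T z) n - avg T f z n) @[n --> \oo] --> 0.
Proof.
move=> cf; have [B B0 fB] := continuous_bounded X_compact cf.
apply/cvgrPdist_le => e e0.
have : \forall n \near \oo, 2 * B / e <= n%:R :> R by exact: nbhs_infty_ger.
apply: filter_app; exists 1%N => // n /= n0; rewrite ler_pdivrMr// => Bn.
rewrite sub0r normrN /avg -mulrBr.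
(* The difference telescopes to two boundary terms, so it is bounded uniformly in [n] before
   division by [n]. *)
have -> : \sum_(k < n) f (iter k T (T z)) - \sum_(k < n) f (iter k T z)
    = f (iter n T z) - f z.
  under eq_bigr do rewrite -iterSr.
  rewrite -(big_mkord xpredT (fun k => f (iter k.+1 T z))).
  by rewrite -(big_mkord xpredT (fun k => f (iter k T z))) -sumrB
    telescope_sumr.
rewrite normrM ger0_norm ?invr_ge0// mulrC ler_pdivrMr ?ltr0n//.
rewrite (le_trans (ler_normB _ _))//.
by have := fB (iter n T z); have := fB z; nra.
Qed.

Lemma avg_iter f z j : continuous f ->
  (avg T f (iter j T z) n - avg T f z n) @[n --> \oo] --> 0.
Proof.
move=> cf; elim: j => [|j IH]; first by under eq_fun do rewrite subrr;
  exact: cvg_cst.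
rewrite -[0](addr0 0).
apply: cvg_trans (cvgD (avg_shift (iter j T z) cf) IH).
by apply: near_eq_cvg; near=> n; rewrite !fctE /=; ring.
Unshelve. all: by end_near. Qed.

Hypotheses (T_trans : topologically_transitive T)
  (T_equi : weak_Banach_mean_equicontinuous T).

Lemma avg_asymptotic f x y : continuous f ->
  (avg T f x n - avg T f y n) @[n --> \oo] --> 0.
Proof.
move=> cf; apply/cvgrPdist_le => e e0.
have e3 : 0 < e / 3 by rewrite divr_gt0.
have [eta eta0 Heta] := BF_avg_near cf e3.
have [dx dx0 Hx] := T_equi x eta0; have [dy dy0 Hy] := T_equi y eta0.
have openB (z : X) d : open [set y : X | mdist z y < d].
  rewrite openE => w /= wd; apply/metricType_numDomainType.nbhs_mdistP.
  exists (d - mdist z w) => [|v /= wv]; first by rewrite /= subr_gt0.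
  by have := metric_triangle z w v; lra.
(* The averages at [x] and [y] are compared through those at [z] and [iter j T z], each of the three
   gaps costing [e / 3]. *)
have [||j [z [/= /Hx xz /Hy yz]]] := T_trans (openB x dx) (openB y dy).
- by exists x; rewrite /= mdistxx.
- by exists y; rewrite /= mdistxx.
have /cvgrPdist_le/(_ _ e3) := avg_iter z j cf.
apply: filterS3 (Heta _ _ xz) (Heta _ _ yz) => n.
by rewrite !sub0r !normrN !ler_norml => /andP[? ?] /andP[? ?] /andP[? ?];
  apply/andP; split; lra.
Qed.
End averages.

(** * Ultrafilter limits and an invariant mean *)

Lemma ultra_bounded_cvg {R : realType} {I : Type} (U : set_system I)
    (u : I -> R) (B : R) :
  UltraFilter U -> (forall i, `|u i| <= B) -> cvg (u @ U).
Proof.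
move=> UU uB.
have uU : (u @ U) [set` `[- B, B]].
  by apply: (@filterE _ U) => i /=; rewrite in_itv/= -ler_norml.
have [l [_ ul]] := @segment_compact R (- B) B (u @ U) _ uU.
apply/cvg_ex; exists l => A lA.
(* An ultrafilter contains the preimage of [A] or of its complement; the latter contradicts [l]
   being a cluster point. *)
have [//|UnA] := in_ultra_setVsetC (u @^-1` A) UU.
by have [? []] := ul (~` A) A UnA lA.
Qed.

Section mean.
Context {R : realType} {X : topologicalType}.

Record mean (c : (X -> R) -> R) : Prop := Mean {
  meanD : forall f g : X -> R, continuous f -> continuous g ->
    c (f \+ g) = c f + c g ;
  mean_ge0 : forall f : X -> R, continuous f -> (forall x, 0 <= f x) ->
    0 <= c f ;
  mean_cst : forall r : R, c (cst r) = r }.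

Lemma le_mean c (f g : X -> R) : mean c -> continuous f -> continuous g ->
  (forall x, f x <= g x) -> c f <= c g.
Proof.
move=> mc cf cg fg.
have cgf : continuous (g \- f) by move=> x; apply: cvgB; [exact: cg|exact: cf].
have -> : g = f \+ (g \- f) by apply/funext => x /=; rewrite addrC subrK.
rewrite (meanD mc)// lerDl; apply: (mean_ge0 mc) => // x /=;
  by rewrite subr_ge0.
Qed.

End mean.

Section krylov_bogolyubov_functional.
Context {R : realType} {X : pointedMetricType R} (T : X -> X).
Hypothesis X_compact : compact [set: X].

Lemma avg_norm_le f x n B : (forall x, `|f x| <= B) -> `|avg T f x n| <= B :> R.
Proof.
move=> fB; have B0 : 0 <= B by exact: le_trans (fB x).
rewrite /avg; case: n => [|n]; first by rewrite invr0 mul0r normr0.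
rewrite normrM ger0_norm ?invr_ge0// mulrC ler_pdivrMr//.
rewrite (le_trans (ler_norm_sum _ _ _))//.
apply: (@le_trans _ _ (\sum_(k < n.+1) B)); first by apply: ler_sum.
by rewrite sumr_const card_ord mulr_natr.
Qed.

(** Limits along [U] exist for every continuous [f] and respect sums and signs. As [U] refines the
    eventual filter, they agree with ordinary limits whenever those exist; the last clause later
    identifies [c] with integrals. *)
Lemma invariant_mean : exists c : (X -> R) -> R, [/\ mean c,
  forall f : X -> R, continuous f -> c (f \o T) = c f &
  forall (f : X -> R) l, continuous f -> avg T f point n @[n --> \oo] --> l ->
    c f = l].
Proof.
have [U [UU ooU]] := ultraFilterLemma (eventually_filter).
have UF : ProperFilter U := ultra_proper.
pose c (f : X -> R) : R := lim (avg T f point n @[n --> U]).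
have cc f : continuous f -> avg T f point n @[n --> U] --> c f.
  move=> cf; have [B B0 fB] := continuous_bounded X_compact cf.
  by apply: (@ultra_bounded_cvg _ _ _ _ B) => // n; exact: avg_norm_le.
have climE f l : avg T f point n @[n --> U] --> l -> c f = l.
  by move=> h; apply: cvg_lim.
have clim f l : avg T f point n @[n --> \oo] --> l -> c f = l.
  by move=> h; apply: climE => A /h; exact: ooU.
exists c; split => //; last by move=> f l _; exact: clim.
- split.
  + move=> f g cf cg; apply: climE.
    rewrite [X in X @ _](_ : _ = avg T f point \+ avg T g point); last first.
      by apply/funext => n; rewrite /avg/= big_split/= mulrDr.
    by apply: cvgD; exact: cc.
  + move=> f cf f0; apply: limr_ge; first by apply: cvgP (cc _ cf).
    by apply: nearW => n; rewrite mulr_ge0 ?invr_ge0// sumr_ge0.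
  + move=> r; apply: clim; apply/cvgrPdist_le => e e0; exists 1%N => // n /= n0.
    rewrite /avg/= sumr_const card_ord -[r *+ n]mulr_natl mulrA mulVf ?mul1r
      ?subrr ?normr0 ?ltW//.
    by rewrite pnatr_eq0 -lt0n.
- move=> f cf; apply: climE.
  (* The averages of [f \o T] at [point] are those of [f] at [T point], so the vanishing effect of a
     shift gives invariance. *)
  have h : (avg T f (T point) n - avg T f point n) @[n --> U] --> 0.
    by move=> A /(avg_shift T X_compact point cf); exact: ooU.
  rewrite -[c f]add0r; apply: cvg_trans (cvgD h (cc _ cf)).
  apply: near_eq_cvg; apply: nearW => n; rewrite !fctE subrK /avg.
  by congr (_ * _); apply: eq_bigr => k _; rewrite /= -iterSr.
Qed.

End krylov_bogolyubov_functional.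

(** * Indicators of open sets as increasing limits of continuous functions *)

Lemma lipschitz1_continuous {R : realType} {X : metricType R} (h : X -> R) :
  (forall x y, h x <= h y + mdist x y) -> continuous h.
Proof.
move=> hL x; apply/cvgrPdist_lt => e e0.
apply/metricType_numDomainType.nbhs_mdistP; exists e => // y /= xy.
have := hL x y; have := hL y x; rewrite metric_sym => h1 h2.
by rewrite ltr_norml; apply/andP; split; lra.
Qed.

(** Here [h] is the distance to the complement of [U], capped at [1] so that the supremum is finite
    even for [U = setT]. It is 1-Lipschitz and positive exactly on [U]; the functions are
    [min 1 (n * h)]. *)
Lemma open_exhaustion {R : realType} {X : metricType R} (U : set X) : open U ->
  exists g : nat -> X -> R, [/\ forall n, continuous (g n),
    forall n x, 0 <= g n x <= 1, forall x, nondecreasing_seq (g ^~ x),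
    forall x, U x -> exists n, g n x = 1 & forall n x, ~ U x -> g n x = 0].
Proof.
move=> oU; pose S x := [set r : R | 0 <= r <= 1 /\ ball x r `<=` U].
pose h x := sup (S x).
have S0 x : S x 0.
  by split=> [|y]; rewrite ?lexx ?ler01// ballEmdist/= ltNge mdist_ge0.
have hS x r : S x r -> r <= h x.
  by move=> Sr; apply: ub_le_sup => //; exists 1 => t [/andP[]].
have h0 x : 0 <= h x by exact: hS.
have hub x b : (forall r, S x r -> r <= b) -> h x <= b.
  by move=> Hb; apply: ge_sup => //; exists 0.
have ch : continuous h.
  apply: lipschitz1_continuous => x y; apply: hub => r [/andP[r0 r1] rU].
  have [rd|dr] := leP r (mdist x y); first by rewrite (le_trans rd)// lerDr.
  rewrite -lerBlDr; apply: hS; split.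
    by have := mdist_ge0 x y; move=> ?; apply/andP; split; lra.
  move=> z; rewrite ballEmdist/= => yz; apply: rU; rewrite ballEmdist/=.
  by have := metric_triangle x y z; lra.
have hpos x : U x -> 0 < h x.
  move=> Ux; have /metricType_numDomainType.nbhs_mdistP[d /= d0 dU] :=
    open_nbhs_nbhs (conj oU Ux).
  apply: (@lt_le_trans _ _ (Num.min d 1)); first by rewrite lt_min d0 ltr01.
  apply: hS; split; first by rewrite le_min ltW//= ler01 ge_min lexx orbT.
  by move=> y; rewrite ballEmdist/= lt_min => /andP[yd _]; exact: dU.
have hzero x : ~ U x -> h x = 0.
  move=> nU; apply/eqP; rewrite eq_le h0 andbT; apply: hub => r [_ rU].
  by rewrite leNgt; apply/negP => r0; apply: nU; apply: rU; exact: ballxx.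
exists (fun n x => Num.min 1 (n%:R * h x)); split.
- move=> n x; apply: (@continuous_min _ _ (cst 1) (fun x => n%:R * h x));
    first exact: cvg_cst.
  by apply: cvgM; [exact: cvg_cst|exact: ch].
- move=> n x; rewrite le_min ler01 ge_min lexx /= andbT; exact: mulr_ge0.
- move=> x m n mn; rewrite le_min !ge_min lexx/=.
  by apply/orP; right; rewrite ler_wpM2r// ler_nat.
- move=> x /hpos hx; exists (Num.truncn (h x)^-1).+1; apply/min_idPl.
  by rewrite -ler_pdivrMr// mul1r ltW// truncnS_gt.
- by move=> n x /hzero ->; rewrite mulr0; apply/min_idPr.
Qed.

(** * The outer measure of a mean and the Borel probability it induces *)

Section mean_measure.
Context {R : realType} {X : pointedMetricType R} (c : (X -> R) -> R).
Implicit Types (A : set X) (r : R).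

(* Daniell's upper bound, with an increasing sequence in place of a series of
   nonnegative functions so that no double sums arise. *)
Definition mean_cover A r : Prop := exists F : nat -> X -> R,
  [/\ forall n, continuous (F n), forall n x, 0 <= F n x,
      forall x, nondecreasing_seq (F ^~ x), forall n, c (F n) <= r &
      forall x, A x -> exists n, 1 <= F n x].

Definition mean_outer A : R := inf [set r | mean_cover A r].

Hypothesis mc : mean c.

Lemma mean_cover_ge0 A r : mean_cover A r -> 0 <= r.
Proof. by case=> F [cF F0 _ /(_ 0%N) Fr _]; apply: le_trans Fr;
  exact: (mean_ge0 mc). Qed.

Lemma mean_cover1 A : mean_cover A 1.
Proof.
exists (fun _ => cst 1); split.
- by move=> n; exact: cst_continuous.
- by move=> n x /=.
- by move=> x m n mn /=.
- by move=> n; rewrite (mean_cst mc).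
- by move=> x _; exists 0%N.
Qed.

Lemma mean_outer_le A r : mean_cover A r -> mean_outer A <= r.
Proof. by move=> Ar; apply: ge_inf => //; exists 0 => s;
  exact: mean_cover_ge0. Qed.

Lemma mean_outer_has_inf A : has_inf [set r | mean_cover A r].
Proof. by split; [exists 1; exact: mean_cover1 | exists 0 => s;
  exact: mean_cover_ge0]. Qed.

Lemma mean_outer_ge0 A : 0 <= mean_outer A.
Proof. by apply: lb_le_inf; [exists 1; exact: mean_cover1|move=> s;
  exact: mean_cover_ge0]. Qed.

Lemma mean_outer_adherent A e : 0 < e -> exists2 r,
  mean_cover A r & r < mean_outer A + e.
Proof. by move=> e0; apply: inf_adherent => //; exact: mean_outer_has_inf. Qed.

Lemma mean_outer0 : mean_outer set0 = 0.
Proof.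
apply/eqP; rewrite eq_le mean_outer_ge0 andbT; apply: mean_outer_le.
exists (fun _ => cst 0); split.
- by move=> n; exact: cst_continuous.
- by move=> n x /=.
- by move=> x m n mn /=.
- by move=> n; rewrite (mean_cst mc).
- by [].
Qed.

Lemma mean_sum (F : nat -> X -> R) n : (forall j, continuous (F j)) ->
  continuous (fun x => \sum_(j < n) F j x) /\
  c (fun x => \sum_(j < n) F j x) = \sum_(j < n) c (F j).
Proof.
move=> cF; elim: n => [|n [IHc IH]].
  under eq_fun do rewrite big_ord0.
  by rewrite big_ord0; split; [exact: cst_continuous|exact: (mean_cst mc)].
under eq_fun do rewrite big_ord_recr/=.
rewrite big_ord_recr/= -IH; split; last exact: (meanD mc).
by move=> x; apply: cvgD; [exact: IHc|exact: cF].
Qed.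

(** A diagonal choice: the index [n] both counts the sets summed over and selects the function from
    each cover, giving a single increasing sequence. *)
Lemma mean_cover_bigcup A (B : nat -> set X) (r : nat -> R) s :
  A `<=` \bigcup_j B j -> (forall j, mean_cover (B j) (r j)) ->
  (forall n, \sum_(j < n) r j <= s) -> mean_cover A s.
Proof.
move=> AB /choice[F HF] rs.
have cF j n : continuous (F j n) by case: (HF j).
have F0 j n x : 0 <= F j n x by case: (HF j).
exists (fun n x => \sum_(j < n) F j n x); split.
- by move=> n; have [] := mean_sum n (fun j => cF j n).
- by move=> n x; exact: sumr_ge0.
- move=> x m n mn; apply: (@le_trans _ _ (\sum_(j < m) F j n x)).
    by apply: ler_sum => j _; have [_ _ + _ _] := HF j; exact.
  rewrite -!(big_mkord xpredT (fun j => F j n x)) (big_cat_nat _ mn)//= lerDl.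
  exact: sumr_ge0.
- move=> n; have [_ ->] := mean_sum n (fun j => cF j n).
  by apply: le_trans (rs n); apply: ler_sum => j _; have [_ _ _ + _] := HF j;
    exact.
- move=> x /AB[j _ Bx]; have [_ _ ndF _ /(_ _ Bx)[k Fk]] := HF j.
  (* The index must exceed [j] for the [j]-th summand to occur, and reach [k] for that summand to be
     at least [1]. *)
  exists (maxn j.+1 k); have jm : (j < maxn j.+1 k)%N by rewrite leq_maxl.
  rewrite (bigD1 (Ordinal jm))//= (le_trans Fk)//.
  rewrite (le_trans (ndF _ _ _ (leq_maxr j.+1 k)))// lerDl; exact: sumr_ge0.
Qed.

Lemma mean_outer_sigma_subadditive A (B : nat -> set X) :
  A `<=` \bigcup_j B j ->
  ((mean_outer A)%:E <= \sum_(j <oo) (mean_outer (B j))%:E)%E.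
Proof.
move=> AB; apply/lee_addgt0Pr => e e0.
have B0 j : (0 <= (mean_outer (B j))%:E)%E by rewrite lee_fin mean_outer_ge0.
apply: le_trans (epsilon_trick _ B0 (ltW e0)).
have Hr j : exists r, mean_cover (B j) r /\ r <= mean_outer (B j) +
    e / (2 ^ j.+1)%:R.
  have [|r Br rlt] := @mean_outer_adherent (B j) (e / (2 ^ j.+1)%:R).
    by rewrite divr_gt0// ltr0n expn_gt0.
  by exists r; split => //; exact: ltW.
have [r /all_and2[Br rle]] := choice Hr.
set S := (X in (_ <= X)%E).
have Sn n : ((\sum_(j < n) r j)%:E <= S)%E.
  apply: (@le_trans _ _ (\sum_(j < n) ((mean_outer (B j))%:E + (e / (2 ^
    j.+1)%:R)%:E))%E).
    by rewrite -sumEFin; apply: lee_sum => j _; rewrite -EFinD lee_fin.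
  rewrite -(big_mkord xpredT (fun j => ((mean_outer (B j))%:E + (e / (2 ^
    j.+1)%:R)%:E)%E)).
  by apply: nneseries_lim_ge => j _; rewrite -EFinD lee_fin addr_ge0
    ?mean_outer_ge0 ?divr_ge0// ltW.
move: Sn; case: S => [s Sn| |/(_ 0%N)]; [|by rewrite leey|by rewrite big_ord0].
rewrite lee_fin; apply: mean_outer_le; apply: (mean_cover_bigcup AB Br) => n.
by rewrite -lee_fin.
Qed.

(* With [g m] increasing to the indicator of [U], a cover [F] of [A] splits into
   the covers [F n * g n] of [A `&` U] and [F n * (1 - g m)] of [A `&` ~` U],
   for one large [m]. *)
Lemma mean_outer_open_split A U : open U ->
  mean_outer (A `&` U) + mean_outer (A `&` ~` U) <= mean_outer A.
Proof.
move=> /(@open_exhaustion R)[g [cg g01 ndg gU gUC]]; apply/ler_addgt0Pl => e e0.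
have e2 : 0 < e / 2 by rewrite divr_gt0.
have [r [F [cF F0 ndF Fr FA]] rlt] := mean_outer_adherent A e2.
have g0 n x : 0 <= g n x by case/andP: (g01 n x).
have g1 n x : 0 <= 1 - g n x by rewrite subr_ge0; case/andP: (g01 n x).
have cFg m n : continuous (fun x => F n x * g m x).
  by move=> x; apply: cvgM; [exact: cF|exact: cg].
have cFg1 m n : continuous (fun x => F n x * (1 - g m x)).
  move=> x; apply: cvgM; [exact: cF|apply: cvgB; [exact: cvg_cst|exact: cg]].
pose u n := c (fun x => F n x * g n x).
have ur n : u n <= r.
  apply: le_trans (Fr n); apply: (le_mean mc) => // x.
  by rewrite ler_piMr//; case/andP: (g01 n x).
have hsu : has_sup (range u) by split; [exists (u 0%N), 0%N|exists r =>
  _ [n _ <-]].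
have [_ [m _ <-] um] := sup_adherent e2 hsu.
have UA : mean_cover (A `&` U) (sup (range u)).
  exists (fun n x => F n x * g n x); split => //.
  - by move=> n x; exact: mulr_ge0.
  - by move=> x i j ij; apply: ler_pM => //; [exact: ndF|exact: ndg].
  - by move=> n; apply: ub_le_sup; [case: hsu|exists n].
  - move=> x [/FA[n Fn] /gU[k gk]]; exists (maxn n k).
    rewrite -[1]mulr1 ler_pM//; first by rewrite (le_trans Fn)// ndF// leq_maxl.
    by rewrite -gk ndg// leq_maxr.
(* By the choice of [m], [c (F m * g m)] exceeds [sup (range u) - e / 2]; removing this from the
   total [r] leaves the stated bound. *)
have UAC : mean_cover (A `&` ~` U) (r - (sup (range u) - e / 2)).
  exists (fun n x => F n x * (1 - g m x)); split => //.
  - by move=> n x; exact: mulr_ge0.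
  - by move=> x i j ij; apply: ler_wpM2r => //; exact: ndF.
  (* Passing to [maxn m n] bounds the piece outside [U] from above and the piece inside from below
     by [F m * g m]. *)
  - move=> n; apply: (@le_trans _ _ (c (fun x =>
      F (maxn m n) x * (1 - g m x)))).
      by apply: (le_mean mc) => // x; rewrite ler_wpM2r// ndF// leq_maxr.
    rewrite lerBrDr (le_trans _ (Fr (maxn m n)))//.
    have FE : F (maxn m n) = (fun x => F (maxn m n) x * (1 - g m x)) \+
                             (fun x => F (maxn m n) x * g m x).
      by apply/funext => x /=; ring.
    rewrite [leRHS](congr1 c FE) (meanD mc)// lerD2l ltW// (lt_le_trans um)//.
    by apply: (le_mean mc) => // x; rewrite ler_wpM2r// ndF// leq_maxl.
  - by move=> x [/FA[n Fn] /gUC gx]; exists n; rewrite gx subr0 mulr1.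
have := mean_outer_le UA; have := mean_outer_le UAC; lra.
Qed.

Hypothesis X_compact : compact [set: X].

(** A Dini argument: by compactness an increasing cover of the whole space exceeds [1 - e]
    everywhere at a single index, so its mean is at least [1 - e]. *)
Lemma mean_outerT : mean_outer setT = 1.
Proof.
apply/eqP; rewrite eq_le mean_outer_le/=; last exact: mean_cover1.
apply: lb_le_inf; first by exists 1; exact: mean_cover1.
move=> r [F [cF F0 ndF Fr FT]]; apply/ler_addgt0Pr => e e0.
have cov := (compact_near_coveringP _).1 X_compact.
have : \forall n \near \oo, [set: X] `<=` [set x | 1 - e < F n x].
  apply: (cov nat \oo (fun n x => 1 - e < F n x)) => x _.
  have [N FN] := FT x I.
  have FN1 : 1 - e < F N x by lra.
  have : \forall y \near x, 1 - e < F N y.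
    exact: (cF N x _ (lt_nbhsr FN1)).
  move=> xN; exists ([set y | 1 - e < F N y], [set n | (N <= n)%N]) => /=.
    by split => //; exists N.
  by move=> [y n] /= [yN Nn]; apply: lt_le_trans yN _; exact: ndF.
move=> [n _ /(_ n (leqnn n)) Fn].
rewrite -lerBlDr -(mean_cst mc (1 - e)) (le_trans _ (Fr n))//.
by apply: (le_mean mc) => [|//|x]; [exact: cst_continuous|exact/ltW/Fn].
Qed.

Let mu A : \bar R := (mean_outer A)%:E.

Let mu0 : mu set0 = 0%E. Proof. by rewrite /mu mean_outer0. Qed.

Let mu_ge0 A : (0 <= mu A)%E. Proof. by rewrite lee_fin mean_outer_ge0. Qed.

HB.instance Definition _ := isSubsetOuterMeasure.Build R X mu mu0 mu_ge0
  mean_outer_sigma_subadditive.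

(** The Caratheodory sets form a sigma-algebra, and the open splitting inequality puts the open sets
    in it. *)
Let borel_caratheodory (A : set (borel X)) : measurable A -> mu.-caratheodory A.
Proof.
apply: smallest_sub; last first.
  move=> U oU; apply: le_caratheodory_measurable => B; rewrite -EFinD lee_fin.
  exact: mean_outer_open_split.
split.
- exact: caratheodory_measurable_set0.
- by move=> B mB; rewrite setTD; exact: caratheodory_measurable_setC.
- by move=> F mF; exact: caratheodory_measurable_bigcup.
Qed.

Let mu_sigma_additive : semi_sigma_additive (mu : set (borel X) -> \bar R).
Proof.
move=> F mF tF mUF; apply: (@caratheodory_measure_sigma_additive R X mu F _ tF).
- by move=> n; exact: borel_caratheodory.
- exact: borel_caratheodory.
Qed.

Lemma mean_measure : exists mu : probability (borel X) R,
  forall A, mu A = (mean_outer A)%:E.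
Proof.
pose m : set (borel X) -> \bar R := mu.
pose M := isMeasure.Build _ (borel X) R m mu0 mu_ge0 mu_sigma_additive.
pose mM : {measure set (borel X) -> \bar R} := HB.pack m M.
have m1 : m setT = 1%E by rewrite /m /mu mean_outerT.
pose P := Measure_isProbability.Build _ (borel X) R mM m1.
pose mP : probability (borel X) R := HB.pack m mM P.
by exists mP.
Qed.
End mean_measure.

(** * Invariant probabilities, integrals over invariant sets, and comparison with the outer
    measure *)

Section invariant_measures.
Context {R : realType} {X : pointedMetricType R} (T : X -> X).
Hypothesis X_compact : compact [set: X].
Hypothesis T_continuous : continuous T.

Lemma continuous_borel_measurable (f : X -> R) (D : set (borel X)) :
  continuous f -> measurable D -> measurable_fun D (f : borel X -> R).
Proof.
move=> /continuousP cf mD; apply: (measurability _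
  (measurable_realfun.RGenOpens.measurableE R)).
move=> _ [_ [a [b ->] <-]]; apply: measurableI => //.
by apply: sub_sigma_algebra; exact/cf/interval_open.
Qed.

Lemma continuous_borel_self_measurable :
  measurable_fun [set: borel X] (T : borel X -> borel X).
Proof.
apply: (@measurability _ _ (borel X) (borel X) setT T (@open X) erefl) =>
  _ [U oU <-]; rewrite setTI.
by apply: sub_sigma_algebra; move/continuousP : T_continuous; exact.
Qed.

Lemma continuous_integrable (nu : probability (borel X) R) (D : set (borel X))
  (f : X -> R) :
  measurable D -> continuous f -> nu.-integrable D (EFin \o f).
Proof.
move=> mD cf; apply: measurable_bounded_integrable => //.
- by rewrite (le_lt_trans (probability_le1 nu mD))// ltry.
- exact: continuous_borel_measurable.
- have [B B0 fB] := continuous_bounded X_compact cf.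
  by exists B; split; [exact: num_real|move=> r Br x _;
    apply: le_trans (fB x) (ltW Br)].
Qed.

Section invariant_set.
Variables (nu : probability (borel X) R) (D : set (borel X)).
Hypotheses (nu_inv : invariant_measure T nu) (mD : measurable D)
  (TD : T @^-1` D = D).

Lemma integral_comp_invariant (f : X -> R) : continuous f ->
  (\int[nu]_(x in D) (f (T x))%:E = \int[nu]_(x in D) (f x)%:E)%E.
Proof.
move=> cf; have mT := continuous_borel_self_measurable.
have mf : measurable_fun [set: borel X] (EFin \o f : borel X -> \bar R).
  by apply/measurable_EFinP; exact: continuous_borel_measurable.
have cfT : continuous (f \o T) by move=> x; apply: continuous_comp;
  [exact: T_continuous|exact: cf].
have := integral_pushforward mT mf _ mD (mu := nu); rewrite TD => <-;
  last first.
  exact: (@continuous_integrable nu D (f \o T)).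
by apply: eq_measure_integral => A mA _; exact: nu_inv.
Qed.

Lemma iter_continuous k : continuous (iter k T).
Proof.
elim: k => [|k IH] x; first exact: cvg_id.
by apply: continuous_comp; [exact: IH|exact: T_continuous].
Qed.

Lemma integral_iter_invariant (f : X -> R) k : continuous f ->
  (\int[nu]_(x in D) (f (iter k T x))%:E = \int[nu]_(x in D) (f x)%:E)%E.
Proof.
move=> cf; elim: k => [//|k <-].
have cfk : continuous (f \o iter k T).
  by move=> x; apply: continuous_comp; [exact: iter_continuous|exact: cf].
rewrite -(integral_comp_invariant cfk).
by apply: eq_integral => x _; rewrite /= -iterSr.
Qed.

Lemma avg_continuous (f : X -> R) n : continuous f ->
  continuous (fun x => avg T f x n).
Proof.
move=> cf x; apply: cvgM; first exact: cvg_cst.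
apply: (@cvg_big _ _ +%R) => [|k _]; first exact: add_continuous.
by apply: (@continuous_comp _ _ _ (iter k T) f);
  [exact: iter_continuous|exact: cf].
Qed.

Lemma integral_avg_invariant (f : X -> R) n : continuous f -> (0 < n)%N ->
  (\int[nu]_(x in D) (avg T f x n)%:E = \int[nu]_(x in D) (f x)%:E)%E.
Proof.
move=> cf n0.
have ifk (k : 'I_n) : nu.-integrable D (fun x => (f (iter k T x))%:E).
  apply: (@continuous_integrable nu D (f \o iter k T)) => //.
  by move=> x; apply: continuous_comp; [exact: iter_continuous|exact: cf].
under eq_integral do rewrite /avg EFinM -sumEFin.
rewrite integralZl//; last exact: integrable_sum.
rewrite integral_sum//.
under eq_bigr do rewrite integral_iter_invariant//.
have /fineK <- := integrable_fin_num mD (continuous_integrable nu mD cf).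
rewrite sumEFin sumr_const card_ord -EFinM -[(fine _ *+ n)]mulr_natl mulrA
  mulVf ?mul1r//.
by rewrite pnatr_eq0 -lt0n.
Qed.

Hypotheses (T_trans : topologically_transitive T)
  (T_equi : weak_Banach_mean_equicontinuous T).

Lemma avg_cvg_integral (f : X -> R) x : continuous f ->
  avg T f x n * fine (nu D) @[n --> \oo] -->
    fine (\int[nu]_(y in D) (f y)%:E)%E.
Proof.
move=> cf; have [B B0 fB] := continuous_bounded X_compact cf.
have cst_int r : nu.-integrable D (EFin \o cst r : borel X -> \bar R).
  by apply: continuous_integrable => //; exact: cst_continuous.
have fD := integrable_fin_num mD (continuous_integrable nu mD cf).
have nuD : nu D \is a fin_num by exact: fin_num_measure.
have : (\int[nu]_(y in D) (avg T f y n - avg T f x n)%:E)%E @[n --> \oo] -->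
    (\int[nu]_(y in D) cst 0 y)%E.
  apply: (@dominated_cvg _ _ _ nu D mD _ _ (EFin \o cst (2 * B))) => //.
  - move=> n; apply/measurable_EFinP; apply: continuous_borel_measurable =>
      // y.
    by apply: cvgB; [exact: avg_continuous|exact: cvg_cst].
  - by move=> y Dy; apply: cvg_EFin; [by apply: nearW|exact: (avg_asymptotic
      X_compact T_trans T_equi y x cf)].
  - move=> n y Dy /=; rewrite lee_fin (le_trans (ler_normB _ _))//.
    by have := avg_norm_le T y n fB; have := avg_norm_le T x n fB; lra.
rewrite integral_cst// mul0e => h.
have {}h : (fine (\int[nu]_(y in D) (f y)%:E)%E - avg T f x n * fine (nu D))%:E
    @[n --> \oo] --> 0%:E.
  (* The index [0] is excluded because [avg] is [0] there, whatever the integral of [f]. *)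
  apply: cvg_trans h; apply: near_eq_cvg; exists 1%N => // n /= n0.
  under eq_integral do rewrite EFinB.
  have iavg := continuous_integrable nu mD (@avg_continuous f n cf).
  rewrite (integralB_EFin mD iavg (cst_int _)) integral_avg_invariant//.
  have -> : (\int[nu]_(y in D) (cst (avg T f x n) y)%:E = (avg T f x n)%:E * nu
    D)%E.
    exact: (integral_cst nu mD (avg T f x n)%:E).
  by rewrite -[X in (X - _)%E]fineK// -[X in (_ * X)%E]fineK// -EFinM -EFinB.
apply/cvgrPdist_le => e e0.
have /fine_cvgP[_ /cvgrPdist_le/(_ _ e0)] := h.
by apply: filterS => n /=; rewrite sub0r normrN.
Qed.

End invariant_set.

Hypotheses (T_trans : topologically_transitive T)
  (T_equi : weak_Banach_mean_equicontinuous T).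
Variable c : (X -> R) -> R.
Hypothesis mc : mean c.
Hypothesis c_lim : forall (f : X -> R) l, continuous f ->
  avg T f point n @[n --> \oo] --> l -> c f = l.

Lemma integral_mean (nu : probability (borel X) R) (D : set (borel X))
    (f : X -> R) :
  invariant_measure T nu -> measurable D -> T @^-1` D = D -> continuous f ->
  (\int[nu]_(x in D) (f x)%:E = (c f)%:E * nu D)%E.
Proof.
move=> nu_inv mD TD cf.
have fD := integrable_fin_num mD (continuous_integrable nu mD cf).
have nuD : nu D \is a fin_num by exact: fin_num_measure.
(* Over the whole space, the averages at [point] genuinely converge to the integral, so [c_lim]
   makes [c f] equal to it. The same averages times [nu D] converge to the integral over [D], and
   limits are unique. *)
have aT := avg_cvg_integral nu_inv measurableT erefl T_trans T_equi point cf.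
have {}aT : avg T f point n @[n --> \oo] -->
  fine (\int[nu]_(y in setT) (f y)%:E)%E.
  by under eq_fun do rewrite -[avg T f point _]mulr1 -[1]/(fine (1%:E))
    -(probability_setT nu).
have cE := c_lim cf aT; rewrite -cE in aT.
have aD := avg_cvg_integral nu_inv mD TD T_trans T_equi point cf.
rewrite -(fineK fD) -(fineK nuD) -EFinM; congr EFin.
apply: (cvg_unique _ aD); first exact: Rhausdorff.
by apply: cvgM => //; exact: cvg_cst.
Qed.

(** Markov's inequality: on [D], the indicator of [1 <= F n] is at most [F n], whose integral is
    [c (F n) * nu D]. These sets increase to a set containing [A]&[D], so continuity from below
    concludes. *)
Lemma mean_cover_measure_le (nu : probability (borel X) R)
    (A D : set (borel X)) r :
  invariant_measure T nu -> measurable D -> T @^-1` D = D -> measurable A ->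
  mean_cover c A r -> (nu (A `&` D) <= r%:E * nu D)%E.
Proof.
move=> nu_inv mD TD mA [F [cF F0 ndF Fr FA]].
pose E n : set (borel X) := D `&` [set x | 1 <= F n x].
have mE n : measurable (E n).
  have := continuous_borel_measurable (cF n) mD.
  by move=> /(_ mD `[1, +oo[%classic (measurable_itv _));
    rewrite /E preimage_itvcy.
have ndE : nondecreasing_seq E.
  move=> m n mn; apply/subsetPset => x [Dx Fx]; split => //=.
  by apply: le_trans Fx _; exact: ndF.
have ADE : A `&` D `<=` \bigcup_n E n.
  by move=> x [/FA[n Fn] Dx]; exists n.
have mUE : measurable (\bigcup_n E n) by exact: bigcupT_measurable.
apply: (@le_trans _ _ (nu (\bigcup_n E n))).
  by apply: le_measure => //; rewrite inE//; exact: measurableI.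
have cvgE := nondecreasing_cvg_mu mE mUE ndE (mu := nu).
rewrite -(cvg_lim _ cvgE)//; apply: lime_le; first by apply: cvgP cvgE.
apply: nearW => n /=.
apply: (@le_trans _ _ (\int[nu]_(x in D) (F n x)%:E)%E); last first.
  by rewrite integral_mean// lee_wpmul2r// lee_fin.
rewrite -[leLHS]mul1e -integral_cst//.
have mF (B : set (borel X)) : measurable B -> measurable_fun B (EFin \o F n).
  by move=> mB; apply/measurable_EFinP; exact: continuous_borel_measurable.
apply: (@le_trans _ _ (\int[nu]_(x in E n) (F n x)%:E)%E).
  apply: ge0_le_integral => //; first exact: mF.
  by move=> x [_ /=]; rewrite lee_fin.
apply: ge0_subset_integral => //.
- exact: mF.
- by move=> x _; rewrite lee_fin.
- by move=> x [].
Qed.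

Lemma measure_le_mean_outer (nu : probability (borel X) R)
    (A D : set (borel X)) :
  invariant_measure T nu -> measurable D -> T @^-1` D = D -> measurable A ->
  (nu (A `&` D) <= (mean_outer c A)%:E * nu D)%E.
Proof.
move=> nu_inv mD TD mA; apply/lee_addgt0Pr => e e0.
have [r Ar rlt] := mean_outer_adherent mc A e0.
apply: (le_trans (mean_cover_measure_le nu_inv mD TD mA Ar)).
have D1 := probability_le1 nu mD; have D0 : (0 <= nu D)%E by [].
apply: (@le_trans _ _ ((mean_outer c A + e)%:E * nu D)%E).
  by rewrite lee_wpmul2r// lee_fin ltW.
rewrite EFinD muleDl//; last by rewrite fin_num_measure.
by rewrite leeD2l// -[leRHS]mule1 lee_wpmul2l// lee_fin ltW.
Qed.

End invariant_measures.

(** * Invariance of the constructed measure and the conclusion *)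

Lemma mean_outer_preimage {R : realType} {X : pointedMetricType R} (T : X -> X)
    (c : (X -> R) -> R) (A : set X) :
  continuous T -> mean c ->
  (forall f : X -> R, continuous f -> c (f \o T) = c f) ->
  mean_outer c (T @^-1` A) <= mean_outer c A.
Proof.
move=> cT mc cTE; apply: lb_le_inf; first by exists 1; exact: mean_cover1.
move=> r [F [cF F0 ndF Fr FA]]; apply: mean_outer_le => //.
(* Composition with [T] turns a cover of [A] into one of its preimage, with the same means by
   invariance of [c]. *)
exists (fun n => F n \o T); split => //.
- by move=> n x; apply: continuous_comp; [exact: cT|exact: cF].
- by move=> n x; exact: F0.
- by move=> x m n mn; exact: ndF.
- by move=> n; rewrite cTE.
- by move=> x /FA.
Qed.

Section probability_comparison.
Context d (S : measurableType d) (R : realType).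

(** Applying the inequality to the complement reverses it, as both total masses are [1]. The map [h]
    is [preimage T] for invariance of [mu] and [id] for uniqueness. *)
Lemma eq_probability_of_le (mu : probability S R)
    (h : set S -> set S) (nu : probability S R) :
  (forall A, measurable A -> measurable (h A)) ->
  (forall A, h (~` A) = ~` h A) ->
  (forall A, measurable A -> (nu (h A) <= mu A)%E) ->
  forall A, measurable A -> nu (h A) = mu A.
Proof.
move=> mh hC le A mA; apply/eqP; rewrite eq_le le//=.
have := le _ (measurableC mA); rewrite hC !probability_setC//; last exact: mh.
have /fineK <- := fin_num_measure mu A mA.
have /fineK <- := fin_num_measure nu (h A) (mh _ mA).
by rewrite -!EFinB !lee_fin; lra.
Qed.

End probability_comparison.

Theorem corollary5p5 (R : realType) (X : pointedMetricType R) (T : X -> X)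
    (X_compact : compact [set: X]) (T_continuous : continuous T)
    (T_transitive : topologically_transitive T)
    (T_equicontinuous : weak_Banach_mean_equicontinuous T) :
  uniquely_ergodic T.
Proof.
have [c [mc cT c_lim]] := invariant_mean T X_compact.
have [mu muE] := mean_measure mc X_compact.
have mT (A : set (borel X)) : measurable A ->
  measurable (T @^-1` A : set (borel X)).
  by move=> mA; have := continuous_borel_self_measurable T_continuous
    measurableT mA; rewrite setTI.
have mu_inv : invariant_measure T mu.
  apply: (@eq_probability_of_le _ _ _ mu (preimage T) mu) => // A mA.
  by rewrite !muE lee_fin; exact: mean_outer_preimage.
have le_mu := measure_le_mean_outer X_compact T_continuous T_transitive
  T_equicontinuous mc c_lim.
(* For ergodicity the comparison reads [mu D <= mu D * mu D]; as [mu D] lies between [0] and [1], it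
   is [0] or [1]. *)
exists mu; first split => // D mD TD.
  have := le_mu mu D D mu_inv mD TD mD.
  rewrite setIid !muE -EFinM lee_fin => h.
  have D0 := mean_outer_ge0 mc D.
  have D1 : mean_outer c D <= 1 by exact: (mean_outer_le mc (mean_cover1 mc D)).
  have [->|Dn0] := eqVneq (mean_outer c D) 0; [by left|right; congr EFin].
  have : 0 < mean_outer c D by rewrite lt_neqAle eq_sym Dn0.
  by nra.
move=> nu [nu_inv _].
apply: (@eq_probability_of_le _ _ _ mu id nu) => // A mA.
have := le_mu nu A setT nu_inv measurableT erefl mA.
by rewrite setIT probability_setT mule1 muE.
Qed.
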